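(* Let $G=(V,E)$ be a finite loopless multigraph whose edges operate independently with probabilities $p(e)\in[0,1]$, let $K\subseteq V$ with $|K|\ge2$, and let $(G^1,G^2,X)$ be a $K$-splitting of $(G,K)$. Then $\mathbf{r}(G^i)=\mathbf{M}\,\mathbf{p}(G^i)$ for $i=1,2$.
   Context: Labelled set partitions: for a finite set $Y$ and a symbol $l\notin Y$, a labelled set partition of $Y$ is $\pi=\{B_1\cup L_1,\dots,B_k\cup L_k\}$ with $\{B_1,\dots,B_k\}$ a set partition of $Y$ and $L_i\in\{\emptyset,\{l\}\}$ (labelled block iff $L_i=\{l\}$). $\Pi_l(Y)$ is the set of these, ordered by $\sigma\le\pi$ iff every block of $\sigma$ (including $l$ if present) is contained in a block of $\pi$; it is a lattice with join $\vee$. $m(\pi)=1$ if $\pi$ has exactly one labelled block, else $0$. For $\pi\in\Pi_l(W)$ and $Y\subseteq W$, $\pi\sqcap Y\in\Pi_l(Y)$ has blocks $(B\cap Y)\cup L$ for the blocks $B\cup L$ of $\pi$ with $B\cap Y\ne\emptyset$. Graphs may have parallel edges but no loops. A spanning subgraph $H'=(W,F')$ of $H=(W,F)$ has probability $\mathrm{Pr}(H')=\prod_{e\in F'}p(e)\prod_{e\in F\setminus F'}(1-p(e))$. For $K'\subseteq W$: $M(H,K')=1$ if all of $K'$ lies in one connected component, else $0$; $R(H,K')=\sum_{H'}M(H',K')\mathrm{Pr}(H')$ over spanning subgraphs; $\{(H,K')\}\in\Pi_l(W)$ has as blocks the vertex sets of connected components, labelled iff meeting $K'$. For $Y\subseteq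 W$ and a set partition $\rho$ of $Y$, $H_\rho$ identifies the vertices of each block of $\rho$ into one vertex, deletes edges with both endpoints in one block and keeps all other edges with their probabilities; $H_Y=H_{\{Y\}}$. $K$-splitting: $G^i=(V^i,E^i)$ subgraphs of $G$ with $E^1\cup E^2=E$, $E^1\cap E^2=\emptyset$, $V^1\cup V^2=V$, $V^1\cap V^2=X$, $K^i:=K\cap V^i\ne\emptyset$. $K^i_X=(K^i\setminus X)\cup\{X\}$. For a spanning subgraph $H^i$ of $G^i$, $D(H^i,\pi)=1$ if $\{(H^i,K^i)\}\sqcap X=\pi$, else $0$; $P(G^i,\pi)=\sum_{H^i}D(H^i,\pi)M(H^i_X,K^i_X)\mathrm{Pr}(H^i)$. For $\pi=\{B_1\cup L_1,\dots,B_k\cup L_k\}\in\Pi_l(X)$: $G^i_\pi$ is the merging of $G^i$ by $\{B_1,\dots,B_k\}$ and $K^i_\pi=(K^i\setminus X)\cup\{B_j:L_j=\{l\}\text{ or }B_j\cap K^i\ne\emptyset\}$. $\pi_X$ is the partition of $X$ into singletons $\{x\}$, labelled iff $x\in K$; $\Pi_l(X,\pi_X)=\{\pi\in\Pi_l(X):\pi\ge\pi_X,\ \pi\text{ has a labelled block}\}$. With a fixed ordering of $\Pi_l(X,\pi_X)$: $\mathbf{p}(G^i)=(P(G^i,\pi))_\pi$, $\mathbf{r}(G^i)=(R(G^i_\pi,K^i_\pi))_\pi$, $\mathbf{M}=(m(\pi\vee\sigma))_{\pi,\sigma}$. *)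

(* Defs.v *)
From HB Require Import structures.
From mathcomp Require Import all_boot all_order all_algebra.
Set Implicit Arguments.
Unset Strict Implicit.
Unset Printing Implicit Defensive.
Import Order.TTheory GRing.Theory Num.Theory.
Local Open Scope ring_scope.

(* Labelled set partitions.  The extra symbol l is None : option T, so that a
   block B u L of a labelled set partition is a {set option T}. *)

Section LabelledBlocks.
Variable T : finType.
Implicit Types (S : {set option T}) (B Y : {set T}).

Definition lblock B (b : bool) : {set option T} :=
  [set Some x | x in B] :|: (if b then [set None] else set0).

Definition body S : {set T} := [set x | Some x \in S].

Definition labelled S : bool := None \in S.

(* Injectivity of [body] says that each block of the underlying set partition
   occurs either with or without the label, not both. *)
Definition is_lpart Y (P : {set {set option T}}) : bool :=
  partition (body @: P) Y && dinjectiveb body (mem P).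

Lemma bodyE S x : (x \in body S) = (Some x \in S).
Proof. by rewrite inE. Qed.

Lemma lblockS B b x : (Some x \in lblock B b) = (x \in B).
Proof.
rewrite !inE (mem_imset _ _ Some_inj).
by case: b; rewrite !inE ?orbF.
Qed.

Lemma lblockN B b : labelled (lblock B b) = b.
Proof.
rewrite /labelled inE; have -> : None \in [set Some x | x in B] = false.
  by apply/imsetP => -[].
by case: b; rewrite !inE.
Qed.

Lemma lblockK B b : body (lblock B b) = B.
Proof. by apply/setP => x; rewrite bodyE lblockS. Qed.

Lemma lblock_is_lpart Y (P : {set {set T}}) (b : {set T} -> bool) :
  partition P Y -> is_lpart Y [set lblock B (b B) | B in P].
Proof.
move=> PY; apply/andP; split.
  rewrite -imset_comp (_ : _ @: _ = P) // -[RHS]imset_id.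
  by apply: eq_imset => B /=; rewrite lblockK.
apply/dinjectiveP => _ _ /imsetP[B _ ->] /imsetP[C _ ->].
by rewrite !lblockK => ->.
Qed.

End LabelledBlocks.

Record lpart (T : finType) (Y : {set T}) : Type :=
  LPart { lblocks : {set {set option T}}; _ : is_lpart Y lblocks }.

HB.instance Definition _ (T : finType) (Y : {set T}) :=
  [isSub of @lpart T Y for @lblocks T Y].
HB.instance Definition _ (T : finType) (Y : {set T}) :=
  [Finite of @lpart T Y by <:].

Fact lpart_display : Order.disp_t. Proof. exact: Order.Disp tt tt. Qed.

Section LPartOrder.
Variables (T : finType) (Y : {set T}).
Implicit Types (pi sigma tau : lpart Y) (S U : {set option T}).

Lemma lpart_inj pi S U x :
  S \in lblocks pi -> U \in lblocks pi -> Some x \in S -> Some x \in U -> S = U.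
Proof.
case: pi => P /= /andP[/and3P[_ tI _] /dinjectiveP inj] SP UP xS xU.
apply: inj => //.
have := @def_pblock _ _ (body S) x tI (imset_f _ SP).
rewrite bodyE => /(_ xS) <-.
by apply: def_pblock; rewrite ?bodyE // imset_f.
Qed.

Lemma lpart_ex pi x : reflect (exists2 S, S \in lblocks pi & Some x \in S) (x \in Y).
Proof.
case: pi => P /= /andP[/and3P[/eqP <- _ _] _].
apply: (iffP bigcupP) => [[B /imsetP[S SP ->]]|[S SP xS]].
  by rewrite bodyE; exists S.
by exists (body S); rewrite ?imset_f ?bodyE.
Qed.

Lemma lpart_ne pi S : S \in lblocks pi -> exists x, Some x \in S.
Proof.
case: pi => P /= /andP[/and3P[_ _ n0] _] SP.
have : body S != set0 by apply: contraNneq n0 => <-; rewrite imset_f.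
by case/set0Pn => x; rewrite bodyE; exists x.
Qed.

Definition lp_le sigma pi : bool :=
  [forall S in lblocks sigma, [exists U in lblocks pi, S \subset U]].

Lemma lp_leP sigma pi :
  reflect (forall S, S \in lblocks sigma -> exists2 U, U \in lblocks pi & S \subset U)
          (lp_le sigma pi).
Proof. by apply: (iffP forall_inP) => h S /h /exists_inP. Qed.

Lemma lp_le_refl : reflexive lp_le.
Proof. by move=> pi; apply/lp_leP => S SP; exists S. Qed.

Lemma lp_le_trans : transitive lp_le.
Proof.
move=> tau sigma pi /lp_leP h1 /lp_leP h2; apply/lp_leP => S /h1[U /h2[V V1 V2] SU].
by exists V => //; apply: subset_trans V2.
Qed.

Lemma lp_le_anti : antisymmetric lp_le.
Proof.
have sub sigma pi : lp_le sigma pi -> lp_le pi sigma ->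
    lblocks sigma \subset lblocks pi.
  move=> /lp_leP h1 /lp_leP h2; apply/subsetP => S SP.
  have [U UP SU] := h1 _ SP; have [V VP UV] := h2 _ UP.
  have [x xS] := lpart_ne SP.
  have VS : V = S.
    by apply: (lpart_inj VP SP) (xS); apply: (subsetP UV); apply: (subsetP SU).
  by rewrite (_ : S = U) //; apply/eqP; rewrite eqEsubset SU -VS UV.
move=> sigma pi /andP[h1 h2]; apply/val_inj/eqP.
by rewrite eqEsubset !sub.
Qed.

HB.instance Definition _ :=
  Order.Le_isPOrder.Build lpart_display (lpart Y)
    lp_le_refl lp_le_anti lp_le_trans.

Definition same_block (F : {set {set option T}}) : rel T :=
  fun x y => [exists S in F, (Some x \in S) && (Some y \in S)].

Lemma same_block_equiv F : {in Y & &, equivalence_rel (connect (same_block F))}.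
Proof.
have sym : connect_sym (same_block F).
  apply: sym_connect_sym => x y; apply: eq_existsb => S.
  by rewrite [(Some x \in S) && _]andbC.
move=> x y z _ _ _; split; first exact: connect0.
by move/(same_connect sym).
Qed.

(* The join merges all chains of overlapping blocks of sigma and pi; a merged
   block is labelled iff one of the blocks it is made of is. *)
Definition lp_join_blocks sigma pi : {set {set option T}} :=
  let F := lblocks sigma :|: lblocks pi in
  [set lblock B [exists S in F, labelled S && (body S :&: B != set0)]
     | B in equivalence_partition (connect (same_block F)) Y].

Lemma lp_join_subproof sigma pi : is_lpart Y (lp_join_blocks sigma pi).
Proof. exact/lblock_is_lpart/equivalence_partitionP/same_block_equiv. Qed.

Definition lp_join sigma pi : lpart Y := LPart (lp_join_subproof sigma pi).

Lemma lp_joinP sigma pi tau :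
  lp_le (lp_join sigma pi) tau = lp_le sigma tau && lp_le pi tau.
Proof.
set F := lblocks sigma :|: lblocks pi.
have FY S x : S \in F -> Some x \in S -> x \in Y.
  by rewrite inE => /orP[] SP xS; apply/lpart_ex; exists S; eauto.
have Fne S : S \in F -> exists x, Some x \in S.
  by rewrite inE => /orP[] /lpart_ne.
have up S : S \in F -> exists2 U, U \in lblocks (lp_join sigma pi) & S \subset U.
  move=> SF; have [x xS] := Fne S SF; have xY := FY _ _ SF xS.
  set B := [set y in Y | connect (same_block F) x y].
  have SB y : Some y \in S -> y \in B.
    move=> yS; rewrite inE (FY _ _ SF yS) connect1 //.
    by apply/exists_inP; exists S; rewrite ?xS.
  exists (lblock B [exists S in F, labelled S && (body S :&: B != set0)]).
    apply/imsetP; exists B => //.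
    by apply/imsetP; exists x.
  apply/subsetP => -[y|] yS; first by rewrite lblockS SB.
  rewrite -[_ \in _]/(labelled _) lblockN; apply/exists_inP; exists S => //.
  rewrite /labelled yS; apply/set0Pn; exists x.
  by rewrite inE bodyE xS SB.
apply/idP/andP => [/lp_leP le|[/lp_leP le1 /lp_leP le2]].
  have h S : S \in F -> exists2 U, U \in lblocks tau & S \subset U.
    by move=> /up[V /le[U U1 U2] V2]; exists U => //; apply: subset_trans U2.
  by split; apply/lp_leP => S SP; apply: h; rewrite inE SP ?orbT.
have le S : S \in F -> exists2 U, U \in lblocks tau & S \subset U.
  by rewrite inE => /orP[/le1|/le2].
apply/lp_leP => _ /imsetP[_ /imsetP[x xY ->] ->].
set B := [set _ in _ | _].
have [U UP xU] := lpart_ex tau x xY.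
have inU S y : S \in F -> Some y \in S -> Some y \in U -> S \subset U.
  move=> /le[V VP SV] yS yU.
  by rewrite (lpart_inj UP VP yU) // (subsetP SV).
have BU y : y \in B -> Some y \in U.
  rewrite inE => /andP[_ /connectP[p pth ->]].
  elim: p x xU {xY B} pth => //= z p IH x xU /andP[/exists_inP[S SF /andP[xS zS]]].
  by apply: IH; apply: (subsetP (inU _ _ SF xS xU)).
exists U => //; apply/subsetP => -[y|]; first by rewrite lblockS; apply: BU.
rewrite -[_ \in _]/(labelled _) lblockN => /exists_inP[S SF /andP[lS]].
case/set0Pn => y; rewrite inE bodyE => /andP[yS /BU yU].
exact: (subsetP (inU _ _ SF yS yU)).
Qed.

HB.instance Definition _ :=
  Order.POrder_isJoinSemilattice.Build lpart_display (lpart Y) lp_joinP.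

Definition one_label pi : bool := #|[set S in lblocks pi | labelled S]| == 1%N.

End LPartOrder.

(* pi |-> pi restricted to Z; for Z a subset of Y, Y :&: Z is Z. *)
Section Restriction.
Variables (T : finType) (Y : {set T}) (pi : lpart Y) (Z : {set T}).

Definition lrestr_blocks : {set {set option T}} :=
  [set lblock (body S :&: Z) (labelled S) | S in lblocks pi & body S :&: Z != set0].

Lemma lrestr_subproof : is_lpart (Y :&: Z) lrestr_blocks.
Proof.
have inj S U x : S \in lblocks pi -> U \in lblocks pi ->
    x \in body S :&: Z -> x \in body U :&: Z -> S = U.
  rewrite !inE => SP UP /andP[xS _] /andP[xU _].
  exact: lpart_inj SP UP xS xU.
apply/andP; split; last first.
  apply/dinjectiveP => _ _ /imsetP[S + ->] /imsetP[U + ->].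
  rewrite inE => /andP[SP /set0Pn[x xS]].
  rewrite inE !lblockK => /andP[UP _] e.
  by have xU := xS; rewrite e in xU; rewrite (inj S U x).
rewrite -imset_comp; apply/and3P; split.
- apply/eqP/setP => x; apply/bigcupP/idP.
    move=> [_ /imsetP[S + ->]] /=; rewrite inE lblockK !inE => /andP[SP _].
    by move=> /andP[xS ->]; rewrite andbT; apply/(lpart_ex pi); exists S.
  rewrite inE => /andP[/(lpart_ex pi)[S SP xS] xZ].
  have xSZ : x \in body S :&: Z by rewrite !inE xS.
  exists (body S :&: Z) => //; apply/imsetP; exists S; last by rewrite /= lblockK.
  by rewrite inE SP; apply/set0Pn; exists x.
- apply/trivIsetP => _ _ /imsetP[S + ->] /imsetP[U + ->] /=.
  rewrite inE => /andP[SP _]; rewrite inE !lblockK => /andP[UP _].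
  apply: contraNT => /pred0Pn[x /= /andP[xS xU]].
  by rewrite (inj S U x).
- apply/imsetP => -[S]; rewrite inE => /andP[_ /negP n0] /=.
  by rewrite lblockK => /esym/eqP.
Qed.

Definition lrestr : lpart (Y :&: Z) := LPart lrestr_subproof.

End Restriction.

(* Loopless multigraphs.  Vertices and edges are finite subsets of ambient
   finite types, so that subgraphs of a graph and the graphs obtained from it by
   merging vertices carry the same edge names (and probabilities). *)

Record multigraph (T E : finType) : Type := Multigraph {
  verts : {set T};
  edges : {set E};
  ends : E -> {set T};
  ends_sub : forall e, e \in edges -> ends e \subset verts;
  ends_card : forall e, e \in edges -> #|ends e| = 2
}.

Section Graphs.
Variables (T E : finType).
Implicit Types (G H : multigraph T E) (K : {set T}) (F : {set E}).

Definition subgraph H G : Prop :=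
  [/\ verts H \subset verts G, edges H \subset edges G
    & {in edges H, ends H =1 ends G}].

Lemma spanning_subproof1 H F e : e \in F :&: edges H -> ends H e \subset verts H.
Proof. by rewrite inE => /andP[_]; apply: ends_sub. Qed.

Lemma spanning_subproof2 H F e : e \in F :&: edges H -> #|ends H e| = 2.
Proof. by rewrite inE => /andP[_]; apply: ends_card. Qed.

Definition spanning H F : multigraph T E :=
  Multigraph (@spanning_subproof1 H F) (@spanning_subproof2 H F).

Definition adjacent H : rel T :=
  fun x y => [exists e in edges H, ends H e == [set x; y]].

Definition components H : {set {set T}} :=
  equivalence_partition (connect (adjacent H)) (verts H).

Definition connects H K : bool := [exists C in components H, K \subset C].

Lemma components_partition H : partition (components H) (verts H).
Proof.
apply: equivalence_partitionP => x y z _ _ _; split; first exact: connect0.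
have sym : connect_sym (adjacent H).
  by apply: sym_connect_sym => u v; apply: eq_existsb => e; rewrite setUC.
by move/(same_connect sym).
Qed.

(* {(H, K)} *)
Definition component_lpart H K : lpart (verts H) :=
  LPart (lblock_is_lpart (fun C => C :&: K != set0) (components_partition H)).

Section Merge.
Variables (H : multigraph T E) (rho : {set {set T}}).

(* In a merged graph, inl x is an unmerged vertex x and inr B is the vertex
   obtained by identifying the vertices of B. *)
Definition merge_vertex (x : T) : T + {set T} :=
  if x \in cover rho then inr (pblock rho x) else inl x.

Definition merge_edges : {set E} :=
  [set e in edges H | [forall B in rho, ~~ (ends H e \subset B)]].

Lemma merge_subproof1 e : e \in merge_edges ->
  merge_vertex @: ends H e \subset merge_vertex @: verts H.
Proof. by rewrite inE => /andP[/ends_sub + _]; apply: imsetS. Qed.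

Lemma merge_subproof2 e : e \in merge_edges -> #|merge_vertex @: ends H e| = 2.
Proof.
rewrite inE => /andP[eH /forall_inP nB].
rewrite card_in_imset ?(ends_card eH) // => x y xe ye.
rewrite /merge_vertex; have [xc|_] := boolP (x \in _); last first.
  by case: ifP => // _ [].
case: ifP => // yc [exy]; apply: contraTeq (nB _ (pblock_mem xc)) => xy.
rewrite negbK; have -> : ends H e = [set x; y].
  apply/esym/eqP; rewrite eqEcard (ends_card eH) cards2 xy leqnn andbT.
  by apply/subsetP => z /set2P[]->.
by apply/subsetP => z /set2P[]->; rewrite ?mem_pblock // exy mem_pblock.
Qed.

Definition merge : multigraph (T + {set T})%type E :=
  Multigraph merge_subproof1 merge_subproof2.

End Merge.

Record ksplitting (G : multigraph T E) (K : {set T})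
    (G1 G2 : multigraph T E) (X : {set T}) : Prop := KSplitting {
  ks_sub1 : subgraph G1 G;
  ks_sub2 : subgraph G2 G;
  ks_edgesU : edges G1 :|: edges G2 = edges G;
  ks_edgesI : edges G1 :&: edges G2 = set0;
  ks_vertsU : verts G1 :|: verts G2 = verts G;
  ks_vertsI : verts G1 :&: verts G2 = X;
  ks_K1 : K :&: verts G1 != set0;
  ks_K2 : K :&: verts G2 != set0
}.

End Graphs.

Definition Pr (R : realFieldType) (T E : finType) (p : E -> R)
    (H : multigraph T E) (F : {set E}) : R :=
  \prod_(e in F) p e * \prod_(e in edges H :\: F) (1 - p e).

Definition reliability (R : realFieldType) (T E : finType) (p : E -> R)
    (H : multigraph T E) (K : {set T}) : R :=
  \sum_(F in powerset (edges H)) (connects (spanning H F) K)%:R * Pr p H F.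

Section Splitting.
Variables (R : realFieldType) (T E : finType) (p : E -> R).
Variables (H : multigraph T E) (K X : {set T}).
Implicit Types pi sigma : lpart X.

(* Throughout, H and K play the role of G^i and K^i. *)

Definition K_X : {set T + {set T}} :=
  [set inl x | x in K :\: X] :|: [set inr X].

Definition induces (F : {set E}) pi : bool :=
  lblocks (lrestr (component_lpart (spanning H F) K) X) == lblocks pi.

Definition splitting_prob pi : R :=
  \sum_(F in powerset (edges H))
    (induces F pi)%:R * (connects (merge (spanning H F) [set X]) K_X)%:R
    * Pr p H F.

Definition merge_lpart pi : multigraph (T + {set T})%type E :=
  merge H [set body S | S in lblocks pi].

Definition K_lpart pi : {set T + {set T}} :=
  [set inl x | x in K :\: X]
  :|: [set inr (body S) | S in lblocks pi & labelled S || (body S :&: K != set0)].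

Definition pvec (s : seq (lpart X)) : 'cV[R]_(size s) :=
  \col_i splitting_prob (tnth (in_tuple s) i).

Definition rvec (s : seq (lpart X)) : 'cV[R]_(size s) :=
  \col_i reliability p (merge_lpart (tnth (in_tuple s) i))
                       (K_lpart (tnth (in_tuple s) i)).

End Splitting.

Definition Mmatrix (R : realFieldType) (T : finType) (X : {set T})
    (s : seq (lpart X)) : 'M[R]_(size s) :=
  \matrix_(i, j)
    (one_label (tnth (in_tuple s) i `|` tnth (in_tuple s) j)%O)%:R.

Section SingletonPartition.
Variables (T : finType) (K X : {set T}).

Lemma singletons_partition : partition [set [set x] | x in X] X.
Proof.
apply/and3P; split.
- apply/eqP/setP => x; apply/bigcupP/idP => [[_ /imsetP[y yX ->] /set1P->]//|xX].
  by exists [set x]; rewrite ?set11 ?imset_f.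
- apply/trivIsetP => _ _ /imsetP[x _ ->] /imsetP[y _ ->] xy.
  by rewrite disjoints1 inE; apply: contraNneq xy => ->.
- by apply/imsetP => -[x _ /setP/(_ x)]; rewrite !inE eqxx.
Qed.

Definition pi_X : lpart X :=
  LPart (lblock_is_lpart (fun B => B :&: K != set0) singletons_partition).

(* Pi_l(X, pi_X) *)
Definition Pi_l_above : {set lpart X} :=
  [set pi : lpart X | (pi_X <= pi)%O
                      && [exists S in lblocks pi, labelled S]].

End SingletonPartition.

(* Main.v *)
(* Fix a set F of operating edges of H = G^i and let sigma be the labelled
   partition of X it induces.  Marginalising over the edges deleted by a merging
   turns R(H_pi, K_pi) into a sum over all F of edges of H, so it is enough to
   show, for each F,
     M(F_pi, K_pi) = M(F_X, K_X) * m(pi \/ sigma).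
   Connectivity in a merged graph is connectivity on the original vertices under
   "adjacent or in the same block"; between vertices of X this relation has the
   blocks of pi \/ sigma as its classes.  If F_X connects K_X, every vertex of K
   reaches a labelled block of sigma, and then K_pi is connected iff all the
   labelled blocks of pi and sigma are merged in pi \/ sigma.  If F_X does not
   connect K_X, neither does the finer merging F_pi connect K_pi, because pi has
   a labelled block. *)
From mathcomp Require Import all_boot all_order all_algebra.
(* Defs comes last so that [merge] is not [path.merge]. *)
Require Import Defs.
Import Order.TTheory GRing.Theory Num.Theory.
Local Open Scope ring_scope.

Set Implicit Arguments.
Unset Strict Implicit.
Unset Printing Implicit Defensive.

(** * Marginalising the edge probabilities *)

(** Expand a product over all edges of [q e + q' e], each factor being 1. Off [A] the pair is (0,
    1), so choices not contained in [A] contribute 0. *)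
Lemma sum_powerset_pr (R : realFieldType) (E : finType) (p : E -> R) (A : {set E}) :
  \sum_(D in powerset A) \prod_(e in D) p e * \prod_(e in A :\: D) (1 - p e) = 1.
Proof.
pose q e := if e \in A then p e else 0; pose q' e := if e \in A then 1 - p e else 1.
transitivity (\prod_e (q e + q' e)); last first.
  by apply: big1 => e _; rewrite /q /q'; case: ifP => _; rewrite ?add0r // addrC subrK.
rewrite bigA_distr [RHS](bigID (mem (powerset A))) /= [X in _ + X]big1 ?addr0 => [|D].
  apply: eq_bigr => D; rewrite inE => DA; rewrite [RHS](bigID (mem D)) /=; congr (_ * _).
    by apply: eq_bigr => e eD; rewrite eD /q (subsetP DA _ eD).
  rewrite [RHS](bigID (mem A)) /= [X in _ * X]big1 ?mulr1 => [|e /andP[/negbTE-> /negbTE eA]].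
    by apply: eq_big => e; rewrite inE // => /andP[/negbTE-> eA]; rewrite /q' eA.
  by rewrite /q' eA.
rewrite inE => /subsetPn[e eD eA].
by rewrite (bigD1 e) //= eD /q (negbTE eA) mul0r.
Qed.

(** Group the sets by their trace on [B]. What is left is a free choice of a subset of [A :\: B],
    whose total probability is 1. This absorbs the edges that a merging deletes. *)
Lemma sum_powerset_marginal (R : realFieldType) (E : finType) (p : E -> R)
    (A B : {set E}) (f : {set E} -> R) : B \subset A ->
  \sum_(F in powerset A)
     f (F :&: B) * (\prod_(e in F) p e * \prod_(e in A :\: F) (1 - p e))
  = \sum_(F in powerset B)
     f F * (\prod_(e in F) p e * \prod_(e in B :\: F) (1 - p e)).
Proof.
move=> BA; rewrite (partition_big (fun F => F :&: B) (mem (powerset B))) /=; last first.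
  by move=> F _; rewrite inE subsetIr.
apply: eq_bigr => F; rewrite inE => FB.
rewrite (eq_bigr (fun J : {set E} => f F * (\prod_(e in J) p e * \prod_(e in A :\: J) (1 - p e))));
  last by move=> J /andP[_ /eqP ->].
rewrite -mulr_sumr; congr (_ * _).
rewrite -[RHS]mulr1 -[X in _ = _ * X](sum_powerset_pr p (A :\: B)) mulr_sumr.
(* The sets with trace [F] on [B] are the unions of [F] with some [D] inside [A :\: B], and the
   probability weight factors accordingly. *)
rewrite (reindex_onto (fun D => F :|: D) (fun J => J :\: B)) /=; last first.
  by move=> J /andP[_ /eqP <-]; rewrite setUC setDE setIC [J :&: _]setIC -setIUl setUC setUCr setTI.
have FD (D : {set E}) : D \subset A :\: B -> [disjoint F & D].
  move=> DAB; apply/pred0P => e /=; apply/negP => /andP[eF /(subsetP DAB)].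
  by rewrite inE (subsetP FB _ eF).
apply: eq_big => [D|D DP].
  rewrite !inE; apply/andP/idP => [[/andP[FDA _] /eqP <-]|DAB].
    by rewrite setSD.
  split; first apply/andP; first split.
  - by rewrite subUset (subset_trans FB) //= (subset_trans DAB) ?subsetDl.
  - apply/eqP/setP => e; rewrite !inE; case: (boolP (e \in F)) => [/(subsetP FB)->//|_] /=.
    by apply/negP => /andP[/(subsetP DAB)]; rewrite inE => /andP[/negP].
  - apply/eqP/setP => e; rewrite !inE; have [eB|eB] /= := boolP (e \in B).
      by apply/esym/negP => /(subsetP DAB); rewrite inE eB.
    by case: (boolP (e \in F)) => // /(subsetP FB); rewrite (negbTE eB).
have DAB : D \subset A :\: B.
  case/andP: DP; rewrite inE => /andP[FDA _] /eqP <-; exact: setSD.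
have -> : A :\: (F :|: D) = (B :\: F) :|: (A :\: B :\: D).
  apply/setP => e; rewrite !inE negb_or.
  have := subsetP BA e; have := subsetP FB e; have := subsetP DAB e; rewrite !inE.
  by case: (e \in A); case: (e \in B); case: (e \in F); case: (e \in D) => //= h1 h2 h3;
    do ?[by have := h1 isT | by have := h2 isT | by have := h3 isT].
have DBF : [disjoint B :\: F & A :\: B :\: D].
  by apply/pred0P => e /=; rewrite !inE; case: (e \in B); rewrite ?andbF.
have prodU (C D' : {set E}) g : [disjoint C & D'] ->
    \prod_(e in C :|: D') g e = \prod_(e in C) g e * \prod_(e in D') g e :> R.
  by move=> CD; rewrite -bigU //; apply: eq_bigl => e; rewrite !inE.
by rewrite !prodU ?FD // mulrACA.
Qed.

(** * Connectivity in merged graphs, expressed on the original vertices *)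

Lemma adjacent_sym (T E : finType) (H : multigraph T E) : symmetric (adjacent H).
Proof. by move=> u v; apply: eq_existsb => e; rewrite setUC. Qed.

Lemma eq_connects (T E : finType) (H H' : multigraph T E) (A : {set T}) :
  verts H = verts H' -> adjacent H =2 adjacent H' -> connects H A = connects H' A.
Proof.
move=> eV /eq_connect eA; rewrite /connects (_ : components H = components H') //.
rewrite /components /equivalence_partition eV; apply: eq_imset => x.
by apply/setP => y; rewrite !inE eA.
Qed.

Lemma connectsP (T E : finType) (H : multigraph T E) (A : {set T}) :
  A \subset verts H -> A != set0 ->
  reflect {in A &, forall x y, connect (adjacent H) x y} (connects H A).
Proof.
move=> AV A0; apply: (iffP exists_inP) => [[_ /imsetP[z _ ->] Acon] x y xA yA|Acon].
  have /[!inE]/andP[_ zx] := subsetP Acon _ xA; have /[!inE]/andP[_] := subsetP Acon _ yA.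
  by apply: connect_trans; rewrite (sym_connect_sym (@adjacent_sym _ _ H)).
have /set0Pn[a aA] := A0; exists [set y in verts H | connect (adjacent H) a y].
  by apply/imsetP; exists a; rewrite ?(subsetP AV).
by apply/subsetP => y yA; rewrite inE Acon ?(subsetP AV).
Qed.

Definition same_part (T : finType) (rho : {set {set T}}) : rel T :=
  fun x y => [exists B in rho, (x \in B) && (y \in B)].

(** Living on [T] rather than on the sum type, these relations can be compared for different
    partitions [rho] of the same graph. *)
Definition merge_rel (T E : finType) (H : multigraph T E) (rho : {set {set T}}) : rel T :=
  fun x y => adjacent H x y || same_part rho x y.

Lemma merge_rel_sym (T E : finType) (H : multigraph T E) rho :
  connect_sym (merge_rel H rho).
Proof.
apply: sym_connect_sym => x y; rewrite /merge_rel adjacent_sym; congr orb.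
by apply: eq_existsb => B; rewrite [(x \in B) && _]andbC.
Qed.

Lemma merge_vertex_eq (T E : finType) (H : multigraph T E) rho x y :
  merge_vertex rho x = merge_vertex rho y -> connect (merge_rel H rho) x y.
Proof.
rewrite /merge_vertex; case: ifP => xc; case: ifP => yc // -[e]; last by rewrite e connect0.
apply/connect1/orP; right; apply/exists_inP; exists (pblock rho x).
  exact: pblock_mem.
by rewrite mem_pblock xc e mem_pblock.
Qed.

Lemma merge_vertex_same (T : finType) (rho : {set {set T}}) x y :
  trivIset rho -> same_part rho x y -> merge_vertex rho x = merge_vertex rho y.
Proof.
move=> tI /exists_inP[B Brho /andP[xB yB]]; rewrite /merge_vertex.
have inc z : z \in B -> z \in cover rho by move=> zB; apply/bigcupP; exists B.
by rewrite !inc // !(def_pblock tI Brho).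
Qed.

Lemma adjacent_merge (T E : finType) (H : multigraph T E) rho u v :
  adjacent (merge H rho) u v ->
  exists c d, [/\ adjacent H c d, u = merge_vertex rho c & v = merge_vertex rho d].
Proof.
move=> /exists_inP[e eM /eqP ee].
have eH : e \in edges H by move: eM; rewrite inE => /andP[].
have /imsetP[c ce uc] : u \in ends (merge H rho) e by rewrite ee set21.
have /imsetP[d de vd] : v \in ends (merge H rho) e by rewrite ee set22.
exists c, d; split=> //; apply/exists_inP; exists e => //.
have cd : c != d.
  apply: contra_eqN (ends_card eM) => /eqP cd.
  by rewrite ee uc vd cd cards2 eqxx.
rewrite eq_sym eqEcard (ends_card eH) cards2 cd leqnn andbT.
by apply/subsetP => z /set2P[]->.
Qed.

(** An edge of the merged graph lifts to an edge of [H], and two lifts of the same merged vertex are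
    equal or share a block. Conversely a step inside a block collapses to a point, and any other
    step is an edge that survives. *)
Lemma connect_merge (T E : finType) (H : multigraph T E) rho x y : trivIset rho ->
  connect (adjacent (merge H rho)) (merge_vertex rho x) (merge_vertex rho y)
  = connect (merge_rel H rho) x y.
Proof.
move=> tI; apply/idP/idP => [/connectP[q]|/connectP[q]].
  elim: q x => [|v q IH] x /=; first by move=> _ /esym; apply: merge_vertex_eq.
  move=> /andP[/adjacent_merge[c [d [cd xc ->]]]] /IH{}IH /IH{}IH.
  apply: connect_trans (merge_vertex_eq H xc) (connect_trans _ IH).
  by apply: connect1; rewrite /merge_rel cd.
elim: q x => [|v q IH] x /=; first by move=> _ ->; apply: connect0.
move=> /andP[xv] /IH{}IH /IH; apply: connect_trans.
(* A step inside a block is handled first, even when it is also an edge, because the merging deletes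
   such edges. *)
have [same|nsame] := boolP (same_part rho x v).
  by rewrite (merge_vertex_same tI same) connect0.
move: xv; rewrite /merge_rel (negbTE nsame) orbF => /exists_inP[e eH /eqP ee].
apply/connect1/exists_inP; exists e; last by rewrite /= ee imsetU1 imset_set1.
rewrite inE eH; apply/forall_inP => B Brho; apply: contra nsame => /subsetP eB.
by apply/exists_inP; exists B; rewrite // !eB ?ee ?set21 ?set22.
Qed.

Lemma connects_mergeP (T E : finType) (H : multigraph T E) rho (A : {set T}) :
  trivIset rho -> A \subset verts H -> A != set0 ->
  reflect {in A &, forall x y, connect (merge_rel H rho) x y}
          (connects (merge H rho) (merge_vertex rho @: A)).
Proof.
move=> tI AV A0; apply: (iffP (connectsP _ _)).
- exact: imsetS.
- by rewrite imset_eq0.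
- by move=> Acon x y xA yA; rewrite -connect_merge // Acon ?imset_f.
- by move=> Acon _ _ /imsetP[x xA ->] /imsetP[y yA ->]; rewrite connect_merge ?Acon.
Qed.

(** * Labels and classes of a join *)

(** Takes an arbitrary family [F], since it is applied to the union of the blocks of two labelled
    partitions, which need not be one itself. *)
Definition labelled_at (T : finType) (F : {set {set option T}}) : pred T :=
  fun x => [exists S in F, labelled S && (Some x \in S)].

Lemma labelled_atU (T : finType) (F F' : {set {set option T}}) x :
  labelled_at (F :|: F') x = labelled_at F x || labelled_at F' x.
Proof.
apply/exists_inP/orP => [[S /setUP[]SF lS]|[]/exists_inP[S SF lS]].
- by left; apply/exists_inP; exists S.
- by right; apply/exists_inP; exists S.
- by exists S; rewrite // inE SF.
- by exists S; rewrite // inE SF orbT.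
Qed.

Lemma same_blockU (T : finType) (F F' : {set {set option T}}) x y :
  same_block (F :|: F') x y = same_block F x y || same_block F' x y.
Proof.
apply/exists_inP/orP => [[S /setUP[]SF lS]|[]/exists_inP[S SF lS]].
- by left; apply/exists_inP; exists S.
- by right; apply/exists_inP; exists S.
- by exists S; rewrite // inE SF.
- by exists S; rewrite // inE SF orbT.
Qed.

Lemma same_block_sym (T : finType) (F : {set {set option T}}) :
  connect_sym (same_block F).
Proof.
apply: sym_connect_sym => x y; apply: eq_existsb => S.
by rewrite [(Some x \in S) && _]andbC.
Qed.

Lemma labelled_at_mem (T : finType) (X : {set T}) (pi : lpart X) x :
  labelled_at (lblocks pi) x -> x \in X.
Proof. by move=> /exists_inP[S SP /andP[_ xS]]; apply/(lpart_ex pi); exists S. Qed.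

(** The labelled blocks of the join are exactly the classes [U x] of points [x] labelled in [F]. So
    there is at most one iff all such points are connected, and the point [a] ensures that there is
    at least one. *)
Lemma one_label_joinP (T : finType) (X : {set T}) (pi sigma : lpart X) a :
  let F := lblocks pi :|: lblocks sigma in labelled_at F a ->
  reflect {in labelled_at F &, forall x y, connect (same_block F) x y}
          (one_label (pi `|` sigma)%O).
Proof.
move=> F aF.
pose U x := lblock [set y in X | connect (same_block F) x y] true.
have FX x : labelled_at F x -> x \in X.
  by rewrite labelled_atU => /orP[] /labelled_at_mem.
have mU W : (W \in [set S in lblocks (pi `|` sigma)%O | labelled S])
    = [exists x in labelled_at F, W == U x].
  rewrite inE; apply/andP/exists_inP => [[/imsetP[_ /imsetP[z zX ->] ->]]|].
    rewrite lblockN => ex; case/exists_inP: (ex) => S SF /andP[lS /set0Pn[x]].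
    rewrite inE bodyE => /andP[xS]; rewrite inE => /andP[xX zx].
    exists x; first by apply/exists_inP; exists S; rewrite ?lS.
    rewrite /U ex; apply/eqP; congr lblock; apply/setP => y.
    by rewrite !inE (same_connect (@same_block_sym _ _) zx).
  case=> x xF /eqP ->; split; last exact: lblockN.
  have xX := FX _ xF; have /exists_inP[S SF /andP[lS xS]] := xF.
  apply/imsetP; exists [set y in X | connect (same_block F) x y].
    by apply/imsetP; exists x.
  rewrite /U; congr lblock; apply/esym/exists_inP; exists S; rewrite ?lS //.
  by apply/set0Pn; exists x; rewrite inE bodyE xS inE xX connect0.
apply: (iffP cards1P) => [[W eW] x y xF yF|con].
  have UW z : labelled_at F z -> U z = W.
    by move=> zF; apply/set1P; rewrite -eW mU; apply/exists_inP; exists z.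
  have : Some y \in U x by rewrite (UW _ xF) -(UW _ yF) lblockS inE FX ?connect0.
  by rewrite lblockS inE => /andP[].
exists (U a); apply/setP => W; rewrite mU in_set1; apply/exists_inP/eqP => [[x xF /eqP->]|->].
  rewrite /U; congr lblock; apply/setP => y.
  by rewrite !inE (same_connect (@same_block_sym _ _) (con _ _ xF aF)).
by exists a.
Qed.

Definition bodies (T : finType) (X : {set T}) (pi : lpart X) : {set {set T}} :=
  [set body S | S in lblocks pi].

Lemma bodies_partition (T : finType) (X : {set T}) (pi : lpart X) :
  partition (bodies pi) X.
Proof. by have /andP[] := valP pi. Qed.

Lemma same_part_bodies (T : finType) (X : {set T}) (pi : lpart X) :
  same_part (bodies pi) =2 same_block (lblocks pi).
Proof.
move=> x y; apply/exists_inP/exists_inP => [[_ /imsetP[S SP ->]]|[S SP xyS]].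
  by rewrite !bodyE => xyS; exists S.
by exists (body S); rewrite ?imset_f ?bodyE.
Qed.

(** * The labelled partition of X induced by a graph *)

Section Induced.
Variables (T E : finType) (H : multigraph T E) (K X : {set T}).
Hypotheses (XH : X \subset verts H) (KH : K \subset verts H).
Variable sigma : lpart X.
Hypothesis sigmaE : lblocks sigma = lblocks (lrestr (component_lpart H K) X).

Let adj := connect (adjacent H).

Let adj_sym x y : adj x y = adj y x.
Proof. exact: (sym_connect_sym (@adjacent_sym _ _ H)). Qed.

Let comp x := [set y in verts H | adj x y].

Lemma induced_blocks S : reflect
  (exists2 x, x \in X & S = lblock (comp x :&: X) (comp x :&: K != set0))
  (S \in lblocks sigma).
Proof.
rewrite sigmaE; apply: (iffP imsetP) => [[S']|[x xX ->]].
  rewrite inE => /andP[/imsetP[C CH ->] ne ->].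
  move: ne; rewrite lblockK lblockN => /set0Pn[x /setIP[xC xX]].
  exists x => //; suff -> : C = comp x by [].
  case/imsetP: CH xC => z zH -> ; rewrite inE => /andP[_ zx].
  apply/setP => y; rewrite !inE.
  by rewrite (same_connect (sym_connect_sym (@adjacent_sym _ _ H)) zx).
exists (lblock (comp x) (comp x :&: K != set0)); last by rewrite lblockK lblockN.
rewrite inE lblockK; apply/andP; split.
  by apply/imsetP; exists (comp x) => //; apply/imsetP; exists x; rewrite ?(subsetP XH).
by apply/set0Pn; exists x; rewrite !inE xX (subsetP XH x xX) /adj connect0.
Qed.

Lemma same_block_induced x y :
  same_block (lblocks sigma) x y = [&& x \in X, y \in X & adj x y].
Proof.
apply/exists_inP/and3P => [[_ /induced_blocks[z zX ->]]|[xX yX xy]].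
  rewrite !lblockS !inE => /andP[/andP[/andP[_ zx] ->] /andP[/andP[_ zy] ->]].
  by split=> //; apply: connect_trans zy; rewrite -/adj adj_sym.
exists (lblock (comp x :&: X) (comp x :&: K != set0)).
  by apply/induced_blocks; exists x.
by rewrite !lblockS !inE xX yX xy !(subsetP XH) //= /adj connect0.
Qed.

Lemma labelled_at_induced x :
  labelled_at (lblocks sigma) x = (x \in X) && [exists k in K, adj x k].
Proof.
apply/exists_inP/andP => [[_ /induced_blocks[z zX ->]]|[xX /exists_inP[k kK xk]]].
  rewrite lblockN lblockS !inE => /andP[/set0Pn[k] + /andP[/andP[_ zx] xX]].
  rewrite !inE => /andP[/andP[_ zk] kK]; split=> //; apply/exists_inP; exists k => //.
  by apply: connect_trans zk; rewrite -/adj adj_sym.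
exists (lblock (comp x :&: X) (comp x :&: K != set0)).
  by apply/induced_blocks; exists x.
rewrite lblockN lblockS !inE xX (subsetP XH) // /adj connect0 !andbT.
by apply/set0Pn; exists k; rewrite !inE kK xk (subsetP KH).
Qed.

(** A block of [sigma] abbreviates a walk in [H] between two points of [X]. Conversely, a walk
    alternates between edges and jumps inside blocks of [pi]; jumps start and end in [X], so each
    stretch of edges between them joins two points of one block of [sigma]. *)
Lemma connect_join (pi : lpart X) x y : x \in X -> y \in X ->
  connect (same_block (lblocks pi :|: lblocks sigma)) x y
  = connect (merge_rel H (bodies pi)) x y.
Proof.
move=> xX yX; apply/idP/idP.
  apply: connect_sub => {xX yX}x {}y.
  rewrite same_blockU same_block_induced -same_part_bodies.
  case/orP => [xy|/and3P[_ _]]; first by apply: connect1; rewrite /merge_rel xy orbT.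
  by apply: connect_sub => u v uv; apply: connect1; rewrite /merge_rel uv.
case/connectP => q pth lst; rewrite lst in yX *.
(* Invariant along the walk: [z] is a point of [X] already reached through the join, and the current
   end of the walk lies in the component of [z]. An edge keeps [z]; a jump moves it to the new
   end. *)
suff [z [zX xz zl]] : exists z, [/\ z \in X,
    connect (same_block (lblocks pi :|: lblocks sigma)) x z & adj z (last x q)].
  apply: connect_trans xz _; apply: connect1.
  by rewrite same_blockU same_block_induced zX yX zl orbT.
elim/last_ind: q pth {lst yX} => [|q v IH] /=; first by exists x; rewrite /adj connect0.
rewrite rcons_path last_rcons => /andP[/IH[z [zX xz zl]]].
case/orP => [lv|]; first by exists z; split=> //; apply: connect_trans zl (connect1 lv).
rewrite same_part_bodies => lv; case/exists_inP: (lv) => S SP /andP[lS vS].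
have lX : last x q \in X by apply/(lpart_ex pi); exists S.
exists v; split; [by apply/(lpart_ex pi); exists S | | exact: connect0].
apply: connect_trans xz (connect_trans (y := last x q) _ _); apply: connect1.
  by rewrite same_blockU same_block_induced zX lX zl orbT.
by rewrite same_blockU lv.
Qed.

(** Up to the first jump the walk uses only edges, and a jump can start only in [X]; without jumps,
    take [y] itself or an earlier point of [X]. *)
Lemma connect_merge_all x y : connect (merge_rel H [set X]) x y -> y \in X ->
  exists2 z, z \in X & adj x z.
Proof.
case/connectP => q + ->; elim: q x => [|v q IH] x /=.
  by move=> _ xX; exists x; rewrite /adj ?connect0.
move=> /andP[/orP[xv|/exists_inP[B /set1P-> /andP[xX _]]] pth lX]; last first.
  by exists x; rewrite /adj ?connect0.
by have [z zX vz] := IH _ pth lX; exists z => //; apply: connect_trans vz; apply: connect1.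
Qed.

End Induced.

(** * Terminal sets of merged graphs as images of vertex sets *)

Lemma labelled_at_ge_pi_X (T : finType) (K X : {set T}) (pi : lpart X) x :
  (pi_X K X <= pi)%O -> x \in K :&: X -> labelled_at (lblocks pi) x.
Proof.
move=> /lp_leP le /setIP[xK xX].
have [|S SP sub] := le (lblock [set x] ([set x] :&: K != set0)).
  by apply/imsetP; exists [set x] => //; apply: imset_f.
have sub' := subsetP sub; apply/exists_inP; exists S => //; apply/andP; split; apply: sub'.
  by rewrite -/(labelled _) lblockN; apply/set0Pn; exists x; rewrite !inE eqxx.
by rewrite lblockS set11.
Qed.

Lemma merge_vertex_bodies (T : finType) (X : {set T}) (pi : lpart X) S x :
  S \in lblocks pi -> Some x \in S -> merge_vertex (bodies pi) x = inr (body S).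
Proof.
move=> SP xS; have /and3P[/eqP cX tI _] := bodies_partition pi.
have xX : x \in X by apply/(lpart_ex pi); exists S.
by rewrite /merge_vertex cX xX (def_pblock tI (imset_f _ SP)) ?bodyE.
Qed.

(** Under the hypothesis a block of [pi] meeting [K] is already labelled, so both ways for a block
    to become a terminal amount to containing a labelled point. *)
Lemma K_lpartE (T : finType) (K X : {set T}) (pi : lpart X) :
  {in K :&: X, forall x, labelled_at (lblocks pi) x} ->
  K_lpart K pi
  = merge_vertex (bodies pi) @: (K :|: [set x | labelled_at (lblocks pi) x]).
Proof.
move=> lab; have /and3P[/eqP cX _ _] := bodies_partition pi.
have outE x : x \notin X -> merge_vertex (bodies pi) x = inl x.
  by move=> xX; rewrite /merge_vertex cX (negbTE xX).
have labE x : labelled_at (lblocks pi) x -> merge_vertex (bodies pi) x \in K_lpart K pi.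
  move=> /exists_inP[S SP /andP[lS xS]]; rewrite (merge_vertex_bodies SP xS).
  by apply/setUP; right; apply/imsetP; exists S; rewrite // inE SP lS.
apply/setP => u; apply/idP/imsetP => [/setUP[]/imsetP[]|[x + ->]].
- move=> x /setDP[xK xX] ->; exists x; last by rewrite outE.
  by rewrite inE xK.
- move=> S; rewrite inE => /andP[SP lS] ->.
  have [x [xS xl]] : exists x, Some x \in S /\ labelled_at (lblocks pi) x.
    case/orP: lS => [lS|/set0Pn[x]].
      have [x xS] := lpart_ne SP; exists x; split=> //.
      by apply/exists_inP; exists S; rewrite ?lS.
    rewrite inE bodyE => /andP[xS xK]; exists x; split=> //; apply: lab.
    by rewrite inE xK; apply/(lpart_ex pi); exists S.
  by exists x; rewrite ?(merge_vertex_bodies SP xS) // !inE xl orbT.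
- move=> /setUP[xK|]; last by rewrite inE => /labE.
  have [xX|xX] := boolP (x \in X); first by apply/labE/lab/setIP.
  by rewrite outE //; apply/setUP; left; apply: imset_f; rewrite inE xX.
Qed.

(** Nonemptiness matters: [K_X] always contains [inr X], which is an image only if [X] has a
    point. *)
Lemma K_XE (T : finType) (K X : {set T}) : X != set0 ->
  K_X K X = merge_vertex [set X] @: (K :|: X).
Proof.
move=> /set0Pn[a aX].
have cX : cover [set X] = X by rewrite /cover big_set1.
have tI : trivIset [set X].
  by apply/trivIsetP => _ _ /set1P-> /set1P->; rewrite eqxx.
have outE x : x \notin X -> merge_vertex [set X] x = inl x.
  by move=> xX; rewrite /merge_vertex cX (negbTE xX).
have inE' x : x \in X -> merge_vertex [set X] x = inr X.
  by move=> xX; rewrite /merge_vertex cX xX (def_pblock tI (set11 X)).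
apply/setP => u; apply/setUP/imsetP => [[/imsetP[x /setDP[xK xX] ->]|/set1P->]|[x]].
- by exists x; rewrite ?outE // inE xK.
- by exists a; rewrite ?inE' // inE aX orbT.
- have [xX _ ->|xX] := boolP (x \in X); first by right; rewrite inE' ?set11.
  rewrite inE (negbTE xX) orbF => xK ->; left; rewrite outE //.
  by apply: imset_f; rewrite inE xX.
Qed.

(** The restriction has type [lpart (verts H :&: X)]; this moves it to [lpart X], where joins with
    [pi] make sense. *)
Lemma induced_exists (T E : finType) (H : multigraph T E) (K X : {set T}) :
  X \subset verts H ->
  exists sigma : lpart X, lblocks sigma = lblocks (lrestr (component_lpart H K) X).
Proof.
move=> XH.
have P : is_lpart X (lblocks (lrestr (component_lpart H K) X)).
  by have := valP (lrestr (component_lpart H K) X); rewrite /= (setIidPr XH).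
by exists (LPart P).
Qed.

(** * The identity for a fixed set of operating edges *)

Section Splitting.
Variables (T E : finType) (H : multigraph T E) (K X : {set T}).
Hypotheses (XH : X \subset verts H) (KH : K :&: verts H != set0).
Let Ki := K :&: verts H.

Let KiH : Ki \subset verts H. Proof. exact: subsetIr. Qed.

Let KiX : Ki :&: X = K :&: X.
Proof. by rewrite -setIA (setIidPr XH). Qed.

Let tX : trivIset [set X].
Proof. by apply/trivIsetP => _ _ /set1P-> /set1P->; rewrite eqxx. Qed.

Variables (pi : lpart X) (a : T).
Hypotheses (pi_ge : (pi_X K X <= pi)%O) (a_lab : labelled_at (lblocks pi) a).

Let L := [set x | labelled_at (lblocks pi) x].

Let aX : a \in X. Proof. exact: labelled_at_mem a_lab. Qed.

Let X0 : X != set0. Proof. by apply/set0Pn; exists a. Qed.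

Let LX : L \subset X.
Proof. by apply/subsetP => x; rewrite inE => /labelled_at_mem. Qed.

Lemma connects_K_lpartP :
  reflect {in Ki :|: L &, forall x y, connect (merge_rel H (bodies pi)) x y}
          (connects (merge H (bodies pi)) (K_lpart Ki pi)).
Proof.
have /and3P[_ tI _] := bodies_partition pi.
rewrite K_lpartE => [|x]; last by rewrite KiX; apply: labelled_at_ge_pi_X.
apply: connects_mergeP => //.
  by rewrite subUset KiH (subset_trans LX).
by apply/set0Pn; exists a; rewrite !inE a_lab orbT.
Qed.

Lemma connects_K_XP :
  reflect {in Ki :|: X &, forall x y, connect (merge_rel H [set X]) x y}
          (connects (merge H [set X]) (K_X Ki X)).
Proof.
rewrite K_XE //; apply: connects_mergeP => //; first by rewrite subUset KiH.
by apply/set0Pn; exists a; rewrite !inE aX orbT.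
Qed.

(** Blocks of [pi] lie inside [X], so every walk for [pi] is also one for the merging of all of [X].
    It takes each terminal to the labelled point [a], with which all of [X] is identified. *)
Lemma connects_K_lpart_K_X :
  connects (merge H (bodies pi)) (K_lpart Ki pi) ->
  connects (merge H [set X]) (K_X Ki X).
Proof.
move=> /connects_K_lpartP con; apply/connects_K_XP.
suff toa x : x \in Ki :|: X -> connect (merge_rel H [set X]) x a.
  move=> x y /toa xa /toa ya; apply: connect_trans xa _.
  by rewrite merge_rel_sym.
have aL : a \in Ki :|: L by rewrite !inE a_lab orbT.
case/setUP => [xK|xX]; last first.
  by apply/connect1/orP; right; apply/exists_inP; exists X; rewrite ?set11 ?xX.
have xL : x \in Ki :|: L by rewrite inE xK.
apply: connect_sub (con _ _ xL aL) => {xK xL}x y /orP[xy|].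
  by apply: connect1; rewrite /merge_rel xy.
rewrite same_part_bodies => /exists_inP[S SP /andP[xS yS]].
apply/connect1/orP; right; apply/exists_inP; exists X; rewrite ?set11 //.
by apply/andP; split; apply/(lpart_ex pi); exists S.
Qed.

Variable sigma : lpart X.
Hypothesis sigmaE : lblocks sigma = lblocks (lrestr (component_lpart H Ki) X).

Lemma induced_ge_pi_X : (pi_X K X <= sigma)%O.
Proof.
apply/lp_leP => _ /imsetP[_ /imsetP[x xX ->] ->].
have /(lpart_ex sigma)[S SP xS] := xX; exists S => //.
apply/subsetP => -[y|]; first by rewrite lblockS => /set1P->.
rewrite -/(labelled _) lblockN => /set0Pn[y]; rewrite !inE => /andP[/eqP-> xK].
have /exists_inP[U UP /andP[lU xU]] : labelled_at (lblocks sigma) x.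
  rewrite (labelled_at_induced XH KiH sigmaE) xX; apply/exists_inP.
  by exists x; rewrite ?connect0 // inE xK (subsetP XH).
by rewrite (lpart_inj SP UP xS xU).
Qed.

Hypothesis conX : connects (merge H [set X]) (K_X Ki X).

(** From [k], follow edges until [X] is met at some [z]; the component of [z] contains the terminal
    [k], so [z] is labelled in [sigma]. *)
Let labelled_reach k : k \in Ki ->
  exists2 z, labelled_at (lblocks sigma) z & connect (adjacent H) k z.
Proof.
move=> kK; have con := connects_K_XP conX.
have /connect_merge_all[//|z zX kz] : connect (merge_rel H [set X]) k a.
  by apply: con; rewrite inE ?kK // aX orbT.
exists z => //; rewrite (labelled_at_induced XH KiH sigmaE) zX.
apply/exists_inP; exists k => //.
by rewrite (sym_connect_sym (@adjacent_sym _ _ H)).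
Qed.

(** Guarantees that the induced partition is among the indices of the vectors; its labelled block
    comes from any terminal. *)
Lemma induced_above : sigma \in Pi_l_above K X.
Proof.
rewrite inE induced_ge_pi_X; have /set0Pn[k kK] := KH.
have [z /exists_inP[S SP /andP[lS _]] _] := labelled_reach kK.
by apply/exists_inP; exists S.
Qed.

Let adj_merge x y : connect (adjacent H) x y -> connect (merge_rel H (bodies pi)) x y.
Proof. by apply: connect_sub => u v uv; apply: connect1; rewrite /merge_rel uv. Qed.

(** Both sides say that a set of points is pairwise connected under [merge_rel H (bodies pi)]:
    [Ki :|: L] on the left, the points labelled in [pi] or [sigma] on the right. Each point of one
    set is connected to a point of the other, so the conditions agree. *)
Lemma connects_K_lpart_one_label :
  connects (merge H (bodies pi)) (K_lpart Ki pi) = one_label (pi `|` sigma)%O.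
Proof.
pose F := lblocks pi :|: lblocks sigma.
have aF : labelled_at F a by rewrite labelled_atU a_lab.
have FX x : labelled_at F x -> x \in X.
  by rewrite labelled_atU => /orP[] /labelled_at_mem.
apply/connects_K_lpartP/(one_label_joinP aF) => con.
  have reach x : labelled_at F x ->
      exists2 k, k \in Ki :|: L & connect (merge_rel H (bodies pi)) x k.
    rewrite labelled_atU => /orP[xl|].
      by exists x; rewrite ?connect0 // !inE xl orbT.
    rewrite (labelled_at_induced XH KiH sigmaE) => /andP[_ /exists_inP[k kK xk]].
    by exists k; rewrite ?adj_merge // inE kK.
  move=> x y xF yF; rewrite (connect_join XH sigmaE) ?FX //.
  have [k kK xk] := reach x xF; have [m mK ym] := reach y yF.
  apply: connect_trans xk (connect_trans (con _ _ kK mK) _).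
  by rewrite merge_rel_sym.
have reach k : k \in Ki :|: L ->
    exists2 x, labelled_at F x & connect (merge_rel H (bodies pi)) k x.
  case/setUP => [/labelled_reach[z zl kz]|].
    by exists z; rewrite ?adj_merge // labelled_atU zl orbT.
  by rewrite inE => kl; exists k; rewrite ?connect0 // labelled_atU kl.
move=> k m /reach[x xF kx] /reach[y yF my].
apply: connect_trans kx _; rewrite merge_rel_sym; apply: connect_trans my _.
by rewrite -(connect_join XH sigmaE) ?FX //; apply: con.
Qed.

End Splitting.

(** * Summation over the sets of operating edges *)

(** Merging commutes with passing to a spanning subgraph, so connectivity depends only on the
    operating edges that survive the merging; the deleted ones marginalise out. *)
Lemma reliability_merge (R : realFieldType) (T E : finType) (p : E -> R)
    (H : multigraph T E) (rho : {set {set T}}) (A : {set T + {set T}}) :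
  reliability p (merge H rho) A
  = \sum_(F in powerset (edges H)) (connects (merge (spanning H F) rho) A)%:R * Pr p H F.
Proof.
have sub : merge_edges H rho \subset edges H by apply/subsetP => e /[!inE]/andP[].
rewrite /reliability /Pr -(@sum_powerset_marginal _ _ _ _ (merge_edges H rho)
  (fun F => (connects (spanning (merge H rho) F) A)%:R) sub).
apply: eq_bigr => F _; congr ((_ : bool)%:R * _); apply: eq_connects => // u v.
by apply: eq_existsb => e; rewrite !inE; case: (e \in F) => //=; rewrite andbb.
Qed.

Lemma rvec_eq (R : realFieldType) (T E : finType) (p : E -> R)
    (H : multigraph T E) (K X : {set T}) (s : seq (lpart X)) :
  X \subset verts H -> K :&: verts H != set0 -> uniq s -> s =i Pi_l_above K X ->
  rvec p H (K :&: verts H) s = Mmatrix R s *m pvec p H (K :&: verts H) s.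
Proof.
move=> XH KH s_uniq s_enum; apply/colP => i; rewrite !mxE.
set pi := tnth _ i.
have : pi \in Pi_l_above K X by rewrite -s_enum mem_tnth.
rewrite inE => /andP[pi_ge /exists_inP[S SP lS]].
have [a aS] := lpart_ne SP.
have a_lab : labelled_at (lblocks pi) a by apply/exists_inP; exists S; rewrite ?lS.
under eq_bigr => j _ do rewrite !mxE -/pi.
rewrite -(big_tnth _ _ _ xpredT (fun sigma => (one_label (pi `|` sigma)%O)%:R
  * splitting_prob p H (K :&: verts H) sigma)).
under eq_bigr => sigma _ do rewrite mulr_sumr.
(* With the sum over edge sets outermost on both sides, compare the terms for one [F]. *)
rewrite exchange_big /= reliability_merge; apply: eq_bigr => F _.
have XHF : X \subset verts (spanning H F) by [].
have KHF : K :&: verts (spanning H F) != set0 by [].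
have [sigma sigmaE] := induced_exists (K :&: verts H) XHF.
have [conX|nconX] := boolP (connects (merge (spanning H F) [set X]) (K_X (K :&: verts H) X));
  last first.
  (* Every summand on the right carries the vanishing factor for the merging of [X]; the left side
     vanishes by contraposition. *)
  rewrite big1 => [|tau _]; last by rewrite mulr0 mul0r mulr0.
  have /contraNF/(_ nconX) := connects_K_lpart_K_X XHF pi_ge a_lab.
  by rewrite /bodies /= => ->; rewrite mul0r.
have sigma_s : sigma \in s.
  by rewrite s_enum; have := induced_above XHF KHF a_lab sigmaE conX.
(* [F] induces only [sigma], so a single summand remains; [uniq s] makes it occur once. *)
rewrite (bigD1_seq sigma) //= big1 => [|tau tau_ne]; last first.
  rewrite /induces -sigmaE (_ : _ == _ = false) ?mul0r ?mulr0 //.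
  by apply: contraNF tau_ne => /eqP/val_inj->.
rewrite /induces -sigmaE eqxx !mul1r addr0.
by rewrite -(connects_K_lpart_one_label XHF pi_ge a_lab sigmaE conX).
Qed.

Theorem theorem5p19 (R : realFieldType) (T E : finType)
    (G G1 G2 : multigraph T E) (p : E -> R) (K X : {set T})
    (s : seq (lpart X))
    (p01 : forall e, e \in edges G -> 0 <= p e <= 1)
    (KG : K \subset verts G) (K2 : (2 <= #|K|)%N)
    (split : ksplitting G K G1 G2 X)
    (s_uniq : uniq s) (s_enum : s =i Pi_l_above K X) :
  rvec p G1 (K :&: verts G1) s
    = Mmatrix R s *m pvec p G1 (K :&: verts G1) s
  /\ rvec p G2 (K :&: verts G2) s
    = Mmatrix R s *m pvec p G2 (K :&: verts G2) s.
Proof.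
case: split => _ _ _ _ _ XE K1 K2'.
by split; apply: rvec_eq => //; rewrite -XE ?subsetIl ?subsetIr.
Qed.
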